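(* Define permutations $\pi^{(n)}$ of length $n$ for $n\ge1$ by $\pi^{(1)}=1$, $\pi^{(2)}=12$, $\pi^{(3)}=132$, $\pi^{(4)}=2413$, and $\pi^{(n)}=2413\circledcirc\pi^{(n-4)}$ for $n\ge5$. Then every simple permutation contained in some $\pi^{(n)}$ belongs to $\{1,\,12,\,21,\,2413,\,25314\}$. Moreover, $\mu[1,\cdot]$ is unbounded on the hereditary class of all permutations contained in some $\pi^{(n)}$; thus there is a hereditary class containing only finitely many simple permutations on which $\mu[1,\pi]$ is unbounded.
   Context: Permutations are written in one-line notation, and $|\pi|$ denotes the length of $\pi$. A permutation $\sigma=\sigma_1\cdots\sigma_m$ is contained in $\pi=\pi_1\cdots\pi_n$, written $\sigma\le\pi$, if there are indices $1\le i_1<\dots<i_m\le n$ such that for all $r,s\in\{1,\dots,m\}$, $\pi_{i_r}<\pi_{i_s}$ if and only if $\sigma_r<\sigma_s$. The set of all (non-empty) permutations of all lengths is a poset under $\le$. A hereditary class is a set of permutations closed downwards under $\le$. The Möbius function on this poset is defined by: $\mu[\sigma,\pi]=0$ if $\sigma\nleq\pi$; $\mu[\pi,\pi]=1$; and for $\sigma<\pi$, $\mu[\sigma,\pi]=-\sum_{\sigma\le\lambda<\pi}\mu[\sigma,\lambda]$. In $\mu[1,\pi]$, the symbol $1$ is the permutation of length 1. An interval in a permutation $\pi$ is a contiguous set of indices $i,i+1,\dots,j$ such that the set of values $\{\pi_i,\dots,\pi_j\}$ is also contiguous. Intervals of length $1$ and $|\pi|$ are trivial; a permutation is simple if all its intervals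 are trivial (so $1$, $12$, $21$ are simple). For a non-empty permutation $\beta$, the 2413-balloon of $\beta$, written $2413\circledcirc\beta$, is the permutation of length $|\beta|+4$ given by $(2413\circledcirc\beta)_1=2$; $(2413\circledcirc\beta)_2=|\beta|+4$; $(2413\circledcirc\beta)_i=\beta_{i-2}+2$ for $2<i\le|\beta|+2$; $(2413\circledcirc\beta)_{|\beta|+3}=1$; $(2413\circledcirc\beta)_{|\beta|+4}=|\beta|+3$. *)

(* Defs.v *)
From HB Require Import structures.
From mathcomp Require Import all_boot all_order all_algebra.
From mathcomp Require Import zify.

Set Implicit Arguments.
Unset Strict Implicit.
Unset Printing Implicit Defensive.

Import Order.TTheory GRing.Theory Num.Theory.

(* Non-empty permutations of arbitrary length in one-line notation. Values are
   1-based, as usual, but positions (the indices given to [nth]) are 0-based. *)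
Definition is_olperm (w : seq nat) : bool :=
  (0 < size w) && perm_eq w (iota 1 (size w)).

Record olperm := OLPerm { word :> seq nat; olpermP : is_olperm word }.

HB.instance Definition _ := [isSub for word].
HB.instance Definition _ := [Choice of olperm by <:].

Definition contains (s p : olperm) : bool :=
  [exists f : {ffun 'I_(size s) -> 'I_(size p)},
     [forall r : 'I_(size s), forall t : 'I_(size s),
        (r < t) ==> (f r < f t)] &&
     [forall r : 'I_(size s), forall t : 'I_(size s),
        (nth 0 p (f r) < nth 0 p (f t)) == (nth 0 s r < nth 0 s t)]].

Lemma containsP (s p : olperm) :
  reflect (exists f : 'I_(size s) -> 'I_(size p),
    (forall r t : 'I_(size s), r < t -> f r < f t) /\
    (forall r t : 'I_(size s), (nth 0 p (f r) < nth 0 p (f t)) = (nth 0 s r < nth 0 s t)))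
  (contains s p).
Proof.
apply: (iffP existsP) => [[f /andP[/forallP Hm /forallP Hp]]|[f [Hm Hp]]].
  exists f; split=> r t; first by move: (Hm r) => /forallP/(_ t)/implyP.
  by move: (Hp r) => /forallP/(_ t)/eqP.
exists (finfun f); apply/andP; split; apply/forallP=> r; apply/forallP=> t.
  by apply/implyP; rewrite !ffunE; apply: Hm.
by rewrite !ffunE Hp.
Qed.

Lemma contains_refl : reflexive contains.
Proof. by move=> p; apply/containsP; exists id. Qed.

Lemma contains_trans : transitive contains.
Proof.
move=> q s p /containsP[f [fm fp]] /containsP[g [gm gp]].
apply/containsP; exists (g \o f); split=> r t /=; last by rewrite gp fp.
by move=> lt_rt; apply/gm/fm.
Qed.

Lemma contains_size (s p : olperm) : contains s p -> size s <= size p.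
Proof.
case/containsP=> f [fm _]; rewrite -(card_ord (size s)) -(card_ord (size p)).
apply: (@leq_card _ _ f) => r t eq_f; apply/val_inj/eqP.
by case: ltngtP => // /fm; rewrite eq_f ltnn.
Qed.

Lemma incr_ge n (f : 'I_n -> 'I_n) :
  (forall r t : 'I_n, r < t -> f r < f t) -> forall i : 'I_n, i <= f i.
Proof.
move=> fm [i Hi] /=; elim: i Hi => // i IH Hi.
have Hi' : i < n by apply: ltnW.
exact: leq_ltn_trans (IH Hi') (fm (Ordinal Hi') (Ordinal Hi) (ltnSn i)).
Qed.

Lemma incr_le n (f : 'I_n -> 'I_n) :
  (forall r t : 'I_n, r < t -> f r < f t) -> forall i : 'I_n, f i <= i.
Proof.
move=> fm i.
pose g (j : 'I_n) := rev_ord (f (rev_ord j)).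
have gm (r t : 'I_n) : r < t -> g r < g t.
  move=> lt_rt; have /fm H : rev_ord t < rev_ord r.
    by rewrite /=; have := ltn_ord t; have := ltn_ord r; lia.
  by rewrite /=; have := ltn_ord (f (rev_ord r)); lia.
have /= := incr_ge gm (rev_ord i).
rewrite rev_ordK; have := ltn_ord (f i); have := ltn_ord i; lia.
Qed.

Lemma count_iota_lt x m n : count (fun y => y < x) (iota m n) = minn (x - m) n.
Proof. by elim: n m => [|n IH] m /=; rewrite ?IH; lia. Qed.

Lemma nth_olpermE (p : olperm) i : i < size p ->
  nth 0 p i = (count (fun y => y < nth 0 p i) p).+1.
Proof.
move=> lt_i; have /andP[_ Hp] := olpermP p.
have : nth 0 p i \in iota 1 (size p) by rewrite -(perm_mem Hp) mem_nth.
by rewrite mem_iota (permP Hp) count_iota_lt; lia.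
Qed.

Lemma contains_eq_size (s p : olperm) :
  contains s p -> size s = size p -> s = p.
Proof.
move=> /containsP[f [fm fp]] eq_sz; apply/val_inj => /=.
move: s p eq_sz f fm fp => [s Hs] [p Hp] /= eq_sz.
rewrite eq_sz => f fm fp.
have f_id i : f i = i.
  by apply/val_inj/eqP; rewrite eqn_leq incr_le //= incr_ge.
apply: (@eq_from_nth _ 0) => // i; rewrite eq_sz => lt_i.
rewrite (nth_olpermE (p := OLPerm Hs)) /= ?eq_sz // (nth_olpermE (p := OLPerm Hp)) //=.
congr _.+1; rewrite -!sum1_count (big_nth 0) [RHS](big_nth 0) eq_sz !big_mkord.
by apply: eq_bigl => j; rewrite -(fp j (Ordinal lt_i)) !f_id.
Qed.

Lemma contains_anti : antisymmetric contains.
Proof.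
move=> s p /andP[sp ps]; apply: (contains_eq_size sp).
by apply/eqP; rewrite eqn_leq !contains_size.
Qed.

Fact containment_display : Order.disp_t. Proof. exact: Order.Disp tt tt. Qed.

HB.instance Definition _ :=
  Order.Le_isPOrder.Build containment_display olperm
    contains_refl contains_anti contains_trans.

Lemma le_olpermE (s p : olperm) : (s <= p)%O = contains s p.
Proof. by []. Qed.

Lemma lt_olperm_size (s p : olperm) : (s < p)%O -> size s < size p.
Proof.
rewrite lt_neqAle => /andP[s_neq_p le_sp].
rewrite ltn_neqAle contains_size // andbT.
by apply: contra s_neq_p => /eqP /(contains_eq_size le_sp) ->.
Qed.

(* All permutations of length at most n, each occurring once. *)
Definition olperms_upto (n : nat) : seq olperm :=
  pmap insub (flatten [seq permutations (iota 1 k) | k <- iota 1 n]).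

Lemma mem_olperms_upto n (p : olperm) : (p \in olperms_upto n) = (size p <= n).
Proof.
rewrite mem_pmap_sub /=; have /andP[p_gt0 Hp] := olpermP p.
apply/flatten_mapP/idP => [[k]|le_pn].
  rewrite mem_iota mem_permutations => Hk /perm_size.
  by rewrite size_iota -[val p]/(word p) => ->; lia.
by exists (size p); rewrite ?mem_permutations // mem_iota; lia.
Qed.

Lemma uniq_olperms_upto n : uniq (olperms_upto n).
Proof.
apply: pmap_sub_uniq.
suff: forall m, uniq (flatten [seq permutations (iota 1 k) | k <- iota m n]) by [].
elim: n => //= n IH m.
rewrite cat_uniq permutations_uniq IH /= andbT; apply/hasPn => w.
case/flatten_mapP=> k; rewrite mem_iota mem_permutations => Hk /perm_size.
rewrite size_iota => sz_w; rewrite mem_permutations.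
by apply/negP => /perm_size; rewrite size_iota; lia.
Qed.

Local Open Scope ring_scope.

(* The fuel k is sufficient as soon as it is at least [size p]: see
   [moebius_rec] below for the defining recursion without fuel. *)
Fixpoint moebius_fuel (k : nat) (s p : olperm) : int :=
  if k isn't k'.+1 then 0 else
  if s == p then 1 else
  if (s < p)%O then
    - \sum_(l <- olperms_upto (size p) | (s <= l < p)%O) moebius_fuel k' s l
  else 0.

Definition moebius (s p : olperm) : int := moebius_fuel (size p) s p.

Lemma moebius_fuelE k (s p : olperm) : (size p <= k)%N -> moebius_fuel k s p = moebius s p.
Proof.
rewrite /moebius; move: {2}(size p) (leqnn (size p)) => n.
elim: n k p => [|n IH] k p le_n le_k.
  by have /andP[] := olpermP p; move: le_n; rewrite leqNgt => /negP.
have /andP[p_gt0 _] := olpermP p.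
case: k le_k => [|k] le_k; first by move: p_gt0; rewrite ltnNge le_k.
rewrite -[in RHS](prednK p_gt0) /=.
case: eqP => // _; case: ifP => // _; congr (- _).
apply: eq_bigr => l /andP[_ /lt_olperm_size lt_lp].
by rewrite !IH //; lia.
Qed.

Lemma moebius_nle (s p : olperm) : ~~ (s <= p)%O -> moebius s p = 0.
Proof.
rewrite /moebius; case: (size p) => //= k nle_sp.
case: eqP nle_sp => [->|_ nle_sp]; first by rewrite lexx.
by case: ifP nle_sp => // /ltW ->.
Qed.

Lemma moebius_refl (p : olperm) : moebius p p = 1.
Proof.
by rewrite /moebius; have /andP[/prednK <- _] := olpermP p; rewrite /= eqxx.
Qed.

Lemma moebius_rec (s p : olperm) : (s < p)%O ->
  moebius s p =
  - \sum_(l <- olperms_upto (size p) | (s <= l < p)%O) moebius s l.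
Proof.
move=> lt_sp; rewrite {1}/moebius; have /andP[/prednK eq_sz _] := olpermP p.
rewrite -{1}eq_sz /= lt_sp (lt_eqF lt_sp); congr (- _).
apply: eq_bigr => l /andP[_ /lt_olperm_size lt_lp].
by rewrite moebius_fuelE //; lia.
Qed.

Local Close Scope ring_scope.

Definition hereditary_class (C : olperm -> Prop) : Prop :=
  forall s p : olperm, (s <= p)%O -> C p -> C s.

Definition unbounded_on (f : olperm -> int) (C : olperm -> Prop) : Prop :=
  forall M : int, exists p : olperm, C p /\ (M < `|f p|)%R.

Definition is_interval (p : olperm) (i j : nat) : Prop :=
  i <= j < size p /\
  exists a b : nat, forall v : nat,
    (exists k : nat, i <= k <= j /\ nth 0 p k = v) <-> a <= v <= b.

Definition simple_olperm (p : olperm) : Prop :=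
  forall i j : nat, is_interval p i j ->
    (j - i).+1 = 1 \/ (j - i).+1 = size p.

Definition p1 : olperm := @OLPerm [:: 1] isT.
Definition p12 : olperm := @OLPerm [:: 1; 2] isT.
Definition p21 : olperm := @OLPerm [:: 2; 1] isT.
Definition p132 : olperm := @OLPerm [:: 1; 3; 2] isT.
Definition p2413 : olperm := @OLPerm [:: 2; 4; 1; 3] isT.
Definition p25314 : olperm := @OLPerm [:: 2; 5; 3; 1; 4] isT.

Definition balloon_word (w : seq nat) : seq nat :=
  [:: 2; size w + 4] ++ [seq x + 2 | x <- w] ++ [:: 1; size w + 3].

Lemma balloon_subproof (b : olperm) : is_olperm (balloon_word b).
Proof.
have /andP[_ Hb] := olpermP b; rewrite /is_olperm /balloon_word /=.
have -> : size ([seq x + 2 | x <- b] ++ [:: 1; size b + 3]) = size b + 2.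
  by rewrite size_cat size_map.
have Hm : perm_eq [seq x + 2 | x <- b] (iota 3 (size b)).
  rewrite (iotaDl 2 1) (eq_map (g := addn 2)) ?perm_map // => x.
  by rewrite addnC.
rewrite iotaD /=; apply/permP => a; move/permP/(_ a): Hm.
rewrite /= !count_cat /= => ->.
have -> : (3 + size b) = size b + 3 by lia.
have -> : (size b + 3).+1 = size b + 4 by lia.
lia.
Qed.

Definition balloon2413 (b : olperm) : olperm := OLPerm (balloon_subproof b).

Lemma size_balloon2413 (b : olperm) : size (balloon2413 b) = size b + 4.
Proof. by rewrite /= size_cat size_map /=; lia. Qed.

(* Meaningful for n >= 1 only; the value at 0 is a dummy. *)
Fixpoint pi_ (n : nat) : olperm :=
  match n with
  | 0 => p1
  | 1 => p1
  | 2 => p12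
  | 3 => p132
  | 4 => p2413
  | m.+4 => balloon2413 (pi_ m)
  end.

Lemma pi_rec n : 5 <= n -> pi_ n = balloon2413 (pi_ (n - 4)).
Proof. by case: n => [|[|[|[|[|n]]]]] // _; rewrite !subSS subn0. Qed.

Lemma size_pi_ n : 1 <= n -> size (pi_ n) = n.
Proof.
elim/ltn_ind: n => -[|[|[|[|[|n]]]]] // IH _.
by rewrite pi_rec // size_balloon2413 IH; lia.
Qed.

Definition pi_class (p : olperm) : Prop :=
  exists n : nat, 1 <= n /\ (p <= pi_ n)%O.

(* Main.v *)
Require Import Defs.
From mathcomp Require Import all_boot all_order all_algebra zify ring.

Set Implicit Arguments.
Unset Strict Implicit.
Unset Printing Implicit Defensive.

Import Order.TTheory GRing.Theory Num.Theory.

(** Write X b for the 2413-balloon of b and f for the Moebius function from the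
permutation 1. The unbounded values come from the identity, valid for every b,
  f (X b) = (1 + [b is 2413 or a balloon]) f b - [b = 1] f 2413
([moebius_balloon]): each further balloon doubles the value. Iterating from 12,
where f is -1, gives - 2 ^ k on the permutations of length 4 k + 6 of the
sequence.

For the identity, surround b by only some of the four outer points of X b. For a
fixed pattern s, the alternating sum of [s occurs in the wrap of b] over the 16
subsets of outer points is
- zero when s is neither 2413 nor a balloon ([altsum_decomposable]): if s does
  not begin with its maximum nor end with its minimum, adding the top or the
  bottom outer point to a subset mostly does not change whether s occurs, and
  the few subsets that are left cancel ([altsum_cancel_sum]); the left and the
  right outer point play this role if s does not begin with its minimum nor end
  with its maximum ([altsum_cancel_skew]), and every s of length at least 2 is
  of one of these kinds;
- [s <= X b] - [s <= b] when s is 2413 or a balloon, since no entry at an end of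
  s is extreme, so that an occurrence which misses an outer point of X b lies
  inside b ([altsum_corner_free]).
Weight this by f s and sum over all s. As f sums to zero over every principal
ideal except that of 1, only [b = 1] is left on the other side, and since
X q <= X b exactly when q <= b ([le_balloon]) the result reads
  f 2413 + (sum over q <= b of f (X q))
         - (sum of f over the q <= b that are 2413 or a balloon) = [b = 1]
([balloon_sum]). Both sides of the claimed identity thus have the same sums over
all principal ideals, hence are equal.

For the simple permutations, a simple permutation of length at least 3 has no
extreme entry at its ends, so if it is below X b then it is below b, or it is
2413, or it is a balloon; and in a balloon X q the copy of q is an interval, so
that q has length 1 and X q is 25314. *)

(** * Patterns in words *)

(** Order isomorphism of words. Working with arbitrary words of naturals lets a
subword of a permutation be used without standardizing it. *)
Definition oiso (u v : seq nat) : bool :=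
  (size u == size v) &&
  [forall i : 'I_(size u), forall j : 'I_(size u),
     (nth 0 u i < nth 0 u j) == (nth 0 v i < nth 0 v j)].

Lemma oisoP u v :
  reflect (size u = size v /\ forall i j, i < size u -> j < size u ->
             (nth 0 u i < nth 0 u j) = (nth 0 v i < nth 0 v j))
          (oiso u v).
Proof.
apply: (iffP andP) => [[/eqP eq_sz /forallP H]|[-> H]].
  split=> // i j lti ltj.
  by have /forallP/(_ (Ordinal ltj))/eqP := H (Ordinal lti).
rewrite eqxx; split=> //; apply/forallP=> i; apply/forallP=> j.
by rewrite H.
Qed.

Lemma oiso_size u v : oiso u v -> size u = size v.
Proof. by case/oisoP. Qed.

Lemma oiso_refl u : oiso u u.
Proof. exact/oisoP. Qed.

Lemma oiso_trans : transitive oiso.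
Proof.
move=> v u w /oisoP[szuv uv] /oisoP[szvw vw]; apply/oisoP.
by split=> [|i j lti ltj]; rewrite ?szuv // uv // vw // -szuv.
Qed.

Lemma oiso_sym u v : oiso u v = oiso v u.
Proof.
by apply/idP/idP=> /oisoP[sz H]; apply/oisoP; split=> // i j lti ltj;
   rewrite H // sz.
Qed.

Lemma oiso_rev u v : oiso u v -> oiso (rev u) (rev v).
Proof.
case/oisoP=> sz H; apply/oisoP; rewrite !size_rev; split=> // i j lti ltj.
by rewrite !nth_rev -?sz // H //; lia.
Qed.

Lemma oiso_addn k u : oiso u [seq x + k | x <- u].
Proof.
apply/oisoP; rewrite size_map; split=> // i j lti ltj.
by rewrite !(nth_map 0) // ltn_add2r.
Qed.

Definition occurs (s p : seq nat) : bool :=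
  [exists m : (size p).-tuple bool, oiso s (mask m p)].

Lemma occursP s p :
  reflect (exists2 u, subseq u p & oiso s u) (occurs s p).
Proof.
apply: (iffP existsP) => [[m Hm]|[u /subseqP[m sz ->] Hu]].
  by exists (mask m p) => //; apply: mask_subseq.
by exists (tcast sz (in_tuple m)); rewrite val_tcast.
Qed.

Lemma occurs_subseq s p q : subseq p q -> occurs s p -> occurs s q.
Proof.
by move=> pq /occursP[u up su]; apply/occursP; exists u => //; apply: subseq_trans pq.
Qed.

Lemma occurs_rev s p : occurs (rev s) (rev p) = occurs s p.
Proof.
suff H s' p' : occurs s' p' -> occurs (rev s') (rev p').
  by apply/idP/idP=> /H; rewrite ?revK.
case/occursP=> u up su; apply/occursP; exists (rev u); last exact: oiso_rev.
by rewrite subseq_rev.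
Qed.

(** Translates between the subsequences of a word and the increasing choices of
positions by which containment of permutations is defined. *)
Lemma subseq_indexP u p :
  subseq u p <-> exists f : nat -> nat,
    (forall i, i < size u -> f i < size p /\ nth 0 u i = nth 0 p (f i)) /\
    (forall i j, i < j < size u -> f i < f j).
Proof.
elim: p u => [|y p IH] [|x u] /=.
- by split=> // _; exists id; split=> // i j; rewrite ltn0 andbF.
- by split=> // -[f [/(_ 0 isT)[]]].
- by split=> // _; exists id; split=> // i j; rewrite ltn0 andbF.
split=> [|[f [fp fm]]].
  case: eqP => [->|_] /IH[f [fp fm]].
    exists (fun i => if i is i'.+1 then (f i').+1 else 0); split=> [[|i]|[|i] [|j]] //=.
    - by rewrite !ltnS; apply: fp.
    - by rewrite !ltnS; apply: fm.
  exists (S \o f); split=> [i /fp //|i j /fm //].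
have [f00|fgt0] := posnP (f 0).
  have eqxy : x = y by have [_ /=] := fp 0 isT; rewrite f00.
  have Hpos i : i < size u -> 0 < f i.+1 by move=> lti; rewrite -f00 fm.
  rewrite eqxy eqxx; apply/IH; exists (predn \o (f \o S)); split=> /= [i lti|i j /andP[ltij ltj]].
    have [/= H1 H2] := fp i.+1 lti; have := Hpos i lti.
    by case: (f i.+1) H1 H2.
  have := Hpos i (ltn_trans ltij ltj); have := fm i.+1 j.+1; rewrite !ltnS ltij => /(_ ltj).
  lia.
have Hpos i : i < (size u).+1 -> 0 < f i.
  by case: i => // i lti; apply: leq_ltn_trans (fm 0 i.+1 _).
have /IH : exists f, (forall i, i < size (x :: u) ->
    f i < size p /\ nth 0 (x :: u) i = nth 0 p (f i)) /\
    (forall i j, i < j < size (x :: u) -> f i < f j).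
  exists (predn \o f); split=> /= [i lti|i j /andP[ltij ltj]].
    have [/= H1 H2] := fp i lti; have := Hpos i lti.
    by case: (f i) H1 H2.
  have := Hpos i (ltn_trans ltij ltj); have := fm i j; rewrite ltij ltj => /(_ isT).
  lia.
by case: eqP => // _ xu; apply: subseq_trans xu; apply: subseq_cons.
Qed.

Lemma occurs_trans s p q : occurs s p -> occurs p q -> occurs s q.
Proof.
case/occursP=> u /subseq_indexP[f [fp fm]] su /occursP[v vq /oisoP[sz_pv pv]].
have eq_su := oiso_size su.
apply: (occurs_subseq vq); apply/occursP.
exists (mkseq (fun i => nth 0 v (f i)) (size u)).
  apply/subseq_indexP; exists f; rewrite size_mkseq; split=> // i lti.
  by rewrite nth_mkseq // -sz_pv; case: (fp i lti).
apply: oiso_trans su _; apply/oisoP; rewrite size_mkseq; split=> // i j lti ltj.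
rewrite !nth_mkseq //; case: (fp i lti) (fp j ltj) => fi -> [fj ->].
exact: pv.
Qed.

Lemma oiso_occurs s p : oiso s p -> occurs s p.
Proof. by move=> sp; apply/occursP; exists p. Qed.

Lemma containsE (s p : olperm) : (s <= p)%O = occurs s p.
Proof.
rewrite le_olpermE; apply/containsP/occursP => [[f [fm fp]]|[u /subseq_indexP[f [fp fm]] /oisoP[sz H]]].
  pose g i := if insub i is Some r then val (f r) else 0.
  have gE i (lti : i < size s) : g i = f (Ordinal lti) by rewrite /g insubT.
  pose u := mkseq (fun i => nth 0 p (g i)) (size s).
  exists u.
    apply/subseq_indexP; exists g; rewrite size_mkseq; split=> [i lti|i j /andP[ltij ltj]].
      by rewrite nth_mkseq // (gE _ lti).
    by rewrite (gE _ ltj) (gE _ (ltn_trans ltij ltj)) fm.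
  apply/oisoP; rewrite size_mkseq; split=> // i j lti ltj.
  by rewrite !nth_mkseq // (gE _ lti) (gE _ ltj) fp.
have ltf (r : 'I_(size s)) : f r < size p by case: (fp r); rewrite -?sz ?ltn_ord.
exists (fun r => Ordinal (ltf r)); split=> r t /=.
  by move=> lt_rt; apply: fm; rewrite lt_rt -sz ltn_ord.
by rewrite H ?ltn_ord // (fp r _).2 -?sz ?ltn_ord // (fp t _).2 -?sz ?ltn_ord.
Qed.

(** The permutation order isomorphic to a word with distinct entries: every entry
is replaced by its rank. *)
Definition std (w : seq nat) : seq nat := [seq count (fun z => z <= x) w | x <- w].

Lemma ltn_count_le w x y : y \in w ->
  (x < y) -> (count (fun z => z <= x) w < count (fun z => z <= y) w).
Proof.
move=> yw ltxy.
apply: leq_trans (_ : (count (fun z => z <= x) w + count_mem y w) <= _).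
  by rewrite -addn1 leq_add2l -has_count has_pred1.
rewrite -count_predUI [X in _ + X](eq_count (a2 := pred0)); last first.
  by move=> z /=; apply/andP=> -[le_zx /eqP eqzy]; move: le_zx; rewrite eqzy leqNgt ltxy.
rewrite count_pred0 addn0; apply: sub_count => z /= /orP[|/eqP->//].
by move/leq_trans; apply; apply: ltnW.
Qed.

Lemma oiso_std w : oiso w (std w).
Proof.
apply/oisoP; rewrite size_map; split=> // i j lti ltj; rewrite !(nth_map 0) //.
apply/idP/idP; first by apply/ltn_count_le/mem_nth.
apply: contraTT; rewrite -!leqNgt => le_ji; apply: sub_count => z /= /leq_trans; exact.
Qed.

Lemma std_olperm w : uniq w -> 0 < size w -> is_olperm (std w).
Proof.
move=> uw w_gt0; rewrite /is_olperm size_map w_gt0 /=.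
have us : uniq (std w).
  rewrite map_inj_in_uniq // => x y xw yw eqc.
  by case: (ltngtP x y) => // /ltn_count_le; [move/(_ w yw)|move/(_ w xw)]; rewrite eqc ltnn.
have sub : {subset std w <= iota 1 (size w)}.
  move=> c /mapP[x xw ->]; rewrite mem_iota -has_count; apply/andP; split.
    by apply/hasP; exists x.
  by rewrite add1n ltnS count_size.
have [|_ eqi] := uniq_min_size us sub; first by rewrite size_map size_iota.
by apply: uniq_perm; rewrite ?iota_uniq.
Qed.

(** * Words with an extreme entry at an end *)

(** The usual order or its opposite: a statement about least first entries and its
mirror image about greatest ones are the two values of [d]. *)
Definition below (d : bool) (x y : nat) : bool := if d then x < y else y < x.

Lemma below_negb d x y : below (~~ d) x y = below d y x.
Proof. by case: d. Qed.

Lemma below_asym d x y : below d x y -> ~~ below d y x.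
Proof. by case: d => /= ?; rewrite -leqNgt ltnW. Qed.

(** The first entry is the least one for [d = true], the greatest one for
[d = false]; for the last entry, apply it to the reversed word. *)
Definition first_extreme (d : bool) (s : seq nat) : bool :=
  if s is x :: v then all (below d x) v else false.

Lemma oiso_below d u v i j : oiso u v -> i < size u -> j < size u ->
  below d (nth 0 u i) (nth 0 u j) = below d (nth 0 v i) (nth 0 v j).
Proof. by case/oisoP=> _ H lti ltj; case: d; apply: H. Qed.

Lemma oiso_first_extreme d u v : oiso u v -> first_extreme d u = first_extreme d v.
Proof.
move=> uv; have := oiso_size uv.
case: u v uv => [|x u] [|y v] //= uv [eq_sz].
apply/(all_nthP 0)/(all_nthP 0) => H i lti.
  by rewrite -(oiso_below d (i := 0) (j := i.+1) uv) //= ?ltnS ?eq_sz // H ?eq_sz.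
by rewrite (oiso_below d (i := 0) (j := i.+1) uv) //= H -?eq_sz.
Qed.

Lemma oiso_behead x u y v : oiso (x :: u) (y :: v) -> oiso u v.
Proof.
by case/oisoP=> -[eq_sz] H; apply/oisoP; split=> // i j lti ltj; apply: (H i.+1 j.+1).
Qed.

Lemma oiso_cons d x u y v :
  all (below d x) u -> all (below d y) v -> oiso u v -> oiso (x :: u) (y :: v).
Proof.
move=> /(all_nthP 0) Hx /(all_nthP 0) Hy uv; case/oisoP: (uv) => eq_sz H.
apply/oisoP; split=> /= [|[|i] [|j]] //=; rewrite ?eq_sz ?ltnn // ?ltnS => lti ltj.
- have := Hx j; have := Hy j; rewrite eq_sz ltj => /(_ isT) + /(_ isT).
  by case: d {Hx Hy} => /= [-> ->|+ +] //; lia.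
- have := Hx i; have := Hy i; rewrite eq_sz lti => /(_ isT) + /(_ isT).
  by case: d {Hx Hy} => /= [+ +|-> ->] //; lia.
- by rewrite H ?eq_sz.
Qed.

(** An extreme first letter of the text can only be matched by an extreme first
letter of the pattern. *)
Lemma occurs_cons d x s v : all (below d x) v -> occurs s (x :: v) ->
  occurs s v \/ exists y s', [/\ s = y :: s', all (below d y) s' & occurs s' v].
Proof.
move=> xv /occursP[[|z u] /=]; first by left; apply/occursP; exists [::]; rewrite ?sub0seq.
case: eqP => [->|_] uv su; last by left; apply/occursP; exists (z :: u).
right; case: s su => [|y s su]; first by move/oiso_size.
exists y, s; split=> //; last by apply/occursP; exists u => //; apply: oiso_behead su.
have /= -> := oiso_first_extreme d su.
by apply/allP=> a /(mem_subseq uv); apply/allP.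
Qed.

Lemma occurs_cons_ext d x v y s :
  all (below d x) v -> all (below d y) s -> occurs s v -> occurs (y :: s) (x :: v).
Proof.
move=> xv ys /occursP[u uv su]; apply/occursP; exists (x :: u); first by rewrite /= eqxx.
apply: (oiso_cons ys) => //; by apply/allP=> a /(mem_subseq uv); apply/allP.
Qed.

Lemma occurs_first d x s v :
  ~~ first_extreme d s -> all (below d x) v -> occurs s (x :: v) = occurs s v.
Proof.
move=> s_n xv; apply/idP/idP; last exact/occurs_subseq/subseq_cons.
by case/(occurs_cons xv) => // -[y [s' [eq_s ys' _]]]; rewrite eq_s /= ys' in s_n.
Qed.

Lemma occurs_rcons d x s v : all (below d x) v -> occurs s (rcons v x) ->
  occurs s v \/ exists y s', [/\ s = rcons s' y, all (below d y) s' & occurs s' v].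
Proof.
rewrite -occurs_rev rev_rcons -all_rev => /occurs_cons xv /xv [|[y [s' [eq_s ys' s'v]]]].
  by rewrite occurs_rev; left.
right; exists y, (rev s'); rewrite -[LHS]revK eq_s rev_cons all_rev; split=> //.
by rewrite -occurs_rev revK.
Qed.

Lemma occurs_last d x s v :
  ~~ first_extreme d (rev s) -> all (below d x) v -> occurs s (rcons v x) = occurs s v.
Proof. by move=> s_n xv; rewrite -occurs_rev rev_rcons (occurs_first s_n) ?all_rev // occurs_rev. Qed.

Lemma occurs_seq1 x v : 0 < size v -> occurs [:: x] v.
Proof.
case: v => // y v _; apply/occursP; exists [:: y]; first by rewrite /= eqxx sub0seq.
by apply: (@oiso_cons true) => //; apply: oiso_refl.
Qed.

(** A pattern of length at least 2 whose last entry is extreme on one side cannot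
begin with the extreme entry of that side, so the first letter of the text is
not used; a pattern of length 1 occurs in every nonempty text. *)
Lemma occurs_rcons_cons d x y s v : 0 < size v ->
  all (below d x) v -> all (below d y) s ->
  occurs (rcons s y) (x :: v) -> occurs (rcons s y) v.
Proof.
move=> v_gt0 xv; case: s => [|z s] /= ys; first by move=> _; apply: occurs_seq1.
rewrite -rcons_cons (occurs_first (d := d)) //= all_rcons negb_and.
by case/andP: ys => /below_asym ->.
Qed.

Lemma occurs_rcons_rcons d x y s v : 0 < size v ->
  all (below (~~ d) x) v -> all (below d y) s ->
  occurs (rcons s y) (rcons v x) -> occurs (rcons s y) v.
Proof.
move=> v_gt0 xv; case: s => [|z s] /= ys; first by move=> _; apply: occurs_seq1.
rewrite -rcons_cons (occurs_last (d := ~~ d)) // rev_rcons /= all_rev /= below_negb negb_and.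
by case/andP: ys => /below_asym ->.
Qed.

(** * Surrounding a word by outer points *)

Section Wrap.
Variables (l t : nat) (m : seq nat) (b r : nat).

(** The word [m] with some of four outer points: [l] and [t] in front, [b] and [r]
behind, as in the balloon. *)
Definition wrap (a1 a2 a3 a4 : bool) : seq nat :=
  nseq a1 l ++ nseq a2 t ++ m ++ nseq a3 b ++ nseq a4 r.

(** The outer points and [m] are in the relative order of a 2413-balloon, so that
[l], [t], [b], [r] are the left, top, bottom and right points of 2413. *)
Definition framed : bool := [&& b < l, l < r, r < t & all (fun x => l < x < r) m].

Lemma framedP : framed -> [/\ [&& b < l, b < r, b < t, l < r, l < t & r < t],
  all (below true l) m, all (below true b) m, all (below false r) m & all (below false t) m].
Proof.
case/and4P=> bl lr rt /allP lmr; split; [lia|..]; apply/allP=> x /lmr /=; lia.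
Qed.

Lemma wrap_subseq a1 a2 a3 a4 c1 c2 c3 c4 :
  a1 ==> c1 -> a2 ==> c2 -> a3 ==> c3 -> a4 ==> c4 ->
  subseq (wrap a1 a2 a3 a4) (wrap c1 c2 c3 c4).
Proof.
have H (x : nat) (a c : bool) : a ==> c -> subseq (nseq a x) (nseq c x).
  by case: a c => [] [] //= _; rewrite eqxx.
by move=> h1 h2 h3 h4; rewrite /wrap !cat_subseq ?H.
Qed.

Local Open Scope ring_scope.

Definition altsum (phi : seq nat -> int) : int :=
  \sum_(a1 : bool) \sum_(a2 : bool) \sum_(a3 : bool) \sum_(a4 : bool)
    (-1) ^+ (a1 + a2 + a3 + a4) * phi (wrap a1 a2 a3 a4).

Lemma altsumE phi : altsum phi =
  phi (wrap false false false false)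
  - phi (wrap true false false false) - phi (wrap false true false false)
  - phi (wrap false false true false) - phi (wrap false false false true)
  + phi (wrap true true false false) + phi (wrap true false true false)
  + phi (wrap true false false true) + phi (wrap false true true false)
  + phi (wrap false true false true) + phi (wrap false false true true)
  - phi (wrap false true true true) - phi (wrap true false true true)
  - phi (wrap true true false true) - phi (wrap true true true false)
  + phi (wrap true true true true).
Proof. by rewrite /altsum !big_bool /=; ring. Qed.

Local Close Scope ring_scope.

Definition occurs_triple (s : seq nat) : bool :=
  [|| occurs s (wrap false true true true), occurs s (wrap true false true true),
      occurs s (wrap true true false true) | occurs s (wrap true true true false)].

Section Cancel.
Variable s : seq nat.
Hypothesis Hframed : framed.
Hypothesis s_gt1 : 1 < size s.
Hypothesis Hfull : occurs s (wrap true true true true) -> occurs_triple s.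

(** As [s] does not begin with its maximum, an outer point [t] in first position is
useless, and so is an outer point [b] in last position since [s] does not end
with its minimum. This cancels 12 of the 16 terms in pairs that differ by such a
point. The others are those of the sets lr, ltr, lbr and ltbr of outer points.
They cancel because [s] occurs in the wrap by ltbr iff it occurs in that by ltr
or in that by lbr, and it occurs in both of these iff it occurs in that by lr. *)
Lemma altsum_cancel_sum :
  ~~ first_extreme false s -> ~~ first_extreme true (rev s) ->
  altsum (fun w => Posz (occurs s w)) = 0%R.
Proof.
move=> s_t s_b; have [/and5P[bl br bt lr /andP[lt rt]] lm bm rm tm] := framedP Hframed.
have E1 v : all (below false t) v -> occurs s (t :: v) = occurs s v.
  exact: occurs_first.
have E2 v : all (below true b) v -> occurs s (v ++ [:: b]) = occurs s v.
  by rewrite cats1; apply: occurs_last.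
have Em1 : occurs s (t :: m) = occurs s m by rewrite E1.
have Em2 : occurs s (t :: m ++ [:: r]) = occurs s (m ++ [:: r]).
  by rewrite E1 // all_cat tm /= ?bl ?br ?bt ?lr ?lt ?rt.
have Em3 : occurs s (t :: m ++ [:: b; r]) = occurs s (m ++ [:: b; r]).
  by rewrite E1 // all_cat tm /= ?bl ?br ?bt ?lr ?lt ?rt.
have Em4 : occurs s (m ++ [:: b]) = occurs s m by rewrite E2.
have Em5 : occurs s (t :: m ++ [:: b]) = occurs s m.
  by rewrite -Em1 -cat_cons E2 //= bm ?bl ?br ?bt ?lr ?lt ?rt.
have Em6 : occurs s (l :: m ++ [:: b]) = occurs s (l :: m).
  by rewrite -cat_cons E2 //= bm ?bl ?br ?bt ?lr ?lt ?rt.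
have Em7 : occurs s (l :: t :: m ++ [:: b]) = occurs s (l :: t :: m).
  by rewrite -2!cat_cons E2 //= bm ?bl ?br ?bt ?lr ?lt ?rt.
(* If the occurrence in the first word avoids [l], then [t] is useless; if that in
   the second word avoids [r], then [b] is useless. Otherwise [s] begins with its
   minimum and ends with its maximum, these are matched by [l] and [r], and the
   rest of [s] avoids [t]. *)
have lrP : occurs s (l :: t :: m ++ [:: r]) && occurs s (l :: m ++ [:: b; r]) =
           occurs s (l :: m ++ [:: r]).
  apply/idP/idP=> [/andP[H1 H2]|H]; last first.
    apply/andP; split; apply: occurs_subseq H; rewrite /= ?eqxx; first exact: subseq_cons.
    exact: cat_subseq (subseq_refl _) (subseq_cons _ _).
  have [|H|[x [s1 [eq_s xs1 H]]]] := @occurs_cons true _ _ _ _ H1.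
  - by rewrite /= all_cat lm /= ?bl ?br ?bt ?lr ?lt ?rt.
  - by move: H; rewrite Em2; apply/occurs_subseq/subseq_cons.
  rewrite -(cat1s b) catA cats1 -rcons_cons in H2.
  have [|H'|[y [s2 [eq_s' ys2 _]]]] := @occurs_rcons false _ _ _ _ H2.
  - by rewrite /= all_cat rm /= ?bl ?br ?bt ?lr ?lt ?rt.
  - by move: H'; rewrite Em6; apply: occurs_subseq; rewrite /= eqxx prefix_subseq.
  move: eq_s' ys2; rewrite eq_s; case: s2 => [[_ eq_s1]|z s3 [_ eq_s1] /= /andP[_ ys3]].
    by have := s_gt1; rewrite eq_s eq_s1.
  rewrite eq_s1 in xs1 H *; apply: (@occurs_cons_ext true) => //.
    by rewrite all_cat lm /= lr.
  by apply: occurs_rcons_cons ys3 H; rewrite ?size_cat ?addn1 // all_cat tm /= rt.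
have fullP : occurs s (l :: t :: m ++ [:: b; r]) =
  occurs s (l :: t :: m ++ [:: r]) || occurs s (l :: m ++ [:: b; r]).
  apply/idP/idP=> [|/orP[]]; last 2 first.
  - exact: occurs_subseq (@wrap_subseq true true false true true true true true isT isT isT isT).
  - exact: occurs_subseq (@wrap_subseq true false true true true true true true isT isT isT isT).
  case/Hfull/or4P; rewrite /wrap /= ?Em3 ?Em7.
  - by move=> H; rewrite orbC (occurs_subseq _ H) // subseq_cons.
  - by move=> ->; rewrite orbT.
  - by move=> ->.
  - by move=> H; rewrite (occurs_subseq _ H) //= !eqxx prefix_subseq.
rewrite altsumE /wrap /= !cats0 fullP -lrP Em1 Em2 Em3 Em4 Em5 Em6 Em7.
case: (occurs s (l :: t :: m ++ _)); case: (occurs s (l :: m ++ [:: b; r])) => /=; ring.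
Qed.

(** The argument of [altsum_cancel_sum] turned by a right angle: [l] and [r] are now
the useless points, and the four terms left are those of tb, tbr, ltb and ltbr.
A rotation involves the inverse permutation, which exchanges positions with
values, so this case is treated directly on words. *)
Lemma altsum_cancel_skew :
  ~~ first_extreme true s -> ~~ first_extreme false (rev s) ->
  altsum (fun w => Posz (occurs s w)) = 0%R.
Proof.
move=> s_l s_r; have [/and5P[bl br bt lr /andP[lt rt]] lm bm rm tm] := framedP Hframed.
have E1 v : all (below true l) v -> occurs s (l :: v) = occurs s v.
  exact: occurs_first.
have E2 v : all (below false r) v -> occurs s (v ++ [:: r]) = occurs s v.
  by rewrite cats1; apply: occurs_last.
have Em1 : occurs s (l :: m) = occurs s m by rewrite E1.
have Em2 : occurs s (m ++ [:: r]) = occurs s m by rewrite E2.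
have Em3 : occurs s (l :: m ++ [:: r]) = occurs s m.
  by rewrite E1 // all_cat lm /= ?bl ?br ?bt ?lr ?lt ?rt.
have Em4 : occurs s (l :: t :: m) = occurs s (t :: m).
  by rewrite E1 //= lm ?bl ?br ?bt ?lr ?lt ?rt.
have Em5 : occurs s (l :: t :: m ++ [:: r]) = occurs s (t :: m ++ [:: r]).
  by rewrite E1 //= all_cat lm /= ?bl ?br ?bt ?lr ?lt ?rt.
have Em6 : occurs s (m ++ [:: b; r]) = occurs s (m ++ [:: b]).
  by rewrite -(cat1s b) catA E2 // all_cat rm /= ?bl ?br ?bt ?lr ?lt ?rt.
have Em7 : occurs s (l :: m ++ [:: b; r]) = occurs s (l :: m ++ [:: b]).
  by rewrite -(cat1s b) catA -cat_cons E2 //= all_cat rm /= ?bl ?br ?bt ?lr ?lt ?rt.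
have tbP : occurs s (t :: m ++ [:: b; r]) && occurs s (l :: t :: m ++ [:: b]) =
           occurs s (t :: m ++ [:: b]).
  apply/idP/idP=> [/andP[H1 H2]|H]; last first.
    apply/andP; split; apply: occurs_subseq H; last exact: subseq_cons.
    rewrite /= eqxx; exact: cat_subseq (subseq_refl _) (prefix_subseq [:: b] _).
  have [|H|[x [s1 [eq_s xs1 H]]]] := @occurs_cons false _ _ _ _ H1.
  - by rewrite all_cat tm /= ?bl ?br ?bt ?lr ?lt ?rt.
  - by move: H; rewrite Em6; apply/occurs_subseq/subseq_cons.
  rewrite -2!cat_cons cats1 in H2.
  have [|H'|[y [s2 [eq_s' ys2 _]]]] := @occurs_rcons true _ _ _ _ H2.
  - by rewrite /= bm /= ?bl ?br ?bt ?lr ?lt ?rt.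
  - by move: H'; rewrite Em4; apply: occurs_subseq; rewrite /= eqxx prefix_subseq.
  move: eq_s' ys2; rewrite eq_s; case: s2 => [[_ eq_s1]|z s3 [_ eq_s1] /= /andP[_ ys3]].
    by have := s_gt1; rewrite eq_s eq_s1.
  rewrite eq_s1 in xs1 H *; apply: (@occurs_cons_ext false) => //.
    by rewrite all_cat tm /= ?bl ?br ?bt ?lr ?lt ?rt.
  apply: (@occurs_rcons_rcons true r) ys3 _; rewrite ?size_cat ?addn1 //.
    by rewrite all_cat rm /= ?bl ?br ?bt ?lr ?lt ?rt.
  by rewrite -[rcons (m ++ _) _]cats1 -catA.
have fullP : occurs s (l :: t :: m ++ [:: b; r]) =
  occurs s (t :: m ++ [:: b; r]) || occurs s (l :: t :: m ++ [:: b]).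
  apply/idP/idP=> [|/orP[]]; last 2 first.
  - exact: occurs_subseq (@wrap_subseq false true true true true true true true isT isT isT isT).
  - exact: occurs_subseq (@wrap_subseq true true true false true true true true isT isT isT isT).
  case/Hfull/or4P; rewrite /wrap /= ?Em5 ?Em7.
  - by move=> ->.
  - move=> H; rewrite orbC (occurs_subseq _ H) //= eqxx; exact: subseq_cons.
  - by move=> H; rewrite (occurs_subseq _ H) //= eqxx; apply: cat_subseq (subseq_cons _ _).
  - by move=> ->; rewrite orbT.
rewrite altsumE /wrap /= !cats0 fullP -tbP Em1 Em2 Em3 Em4 Em5 Em6 Em7.
case: (occurs s (t :: m ++ [:: b; r])); case: (occurs s (l :: t :: m ++ [:: b])) => /=; ring.
Qed.

End Cancel.

(** No entry at an end is extreme, so the permutation has no decomposition as a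
sum or skew sum with a single point. *)
Definition corner_free (s : seq nat) : bool :=
  [&& ~~ first_extreme true s, ~~ first_extreme false s,
      ~~ first_extreme true (rev s) & ~~ first_extreme false (rev s)].

(** Any three or fewer of the outer points can be stripped one at a time, each being
extreme and at an end when its turn comes; a corner-free pattern never uses such
a point. *)
Lemma occurs_corner_free s a1 a2 a3 a4 : framed -> corner_free s ->
  ~~ [&& a1, a2, a3 & a4] -> occurs s (wrap a1 a2 a3 a4) = occurs s m.
Proof.
move=> Hframed /and4P[s_l s_t s_b s_r] Ha.
have [/and5P[bl br bt lr /andP[lt rt]] lm bm rm tm] := framedP Hframed.
apply/idP/idP; last first.
  apply: occurs_subseq; rewrite -[X in subseq X _]/([::] ++ [::] ++ m) /wrap.
  by rewrite !cat_subseq ?sub0seq // -[X in subseq X _]cats0 cat_subseq ?sub0seq.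
have L v : all (below true l) v -> occurs s (l :: v) = occurs s v by apply: occurs_first.
have T v : all (below false t) v -> occurs s (t :: v) = occurs s v by apply: occurs_first.
have B v : all (below true b) v -> occurs s (rcons v b) = occurs s v by apply: occurs_last.
have R v : all (below false r) v -> occurs s (rcons v r) = occurs s v by apply: occurs_last.
have W0 : occurs s (wrap false true true true) = occurs s m.
  rewrite /wrap /= T ?all_cat ?tm /= ?bt ?rt // -(cat1s b) catA !cats1.
  by rewrite R ?B // all_rcons /= br.
have W1 : occurs s (wrap true false true true) = occurs s m.
  rewrite /wrap /= -(cat1s b) catA !cats1 -!rcons_cons R /= ?all_rcons /= ?lr ?br //.
  by rewrite -rcons_cons B /= ?bl // L.
have W2 : occurs s (wrap true true false true) = occurs s m.
  rewrite /wrap /= L /= ?lt ?all_cat ?lm /= ?lr // T ?all_cat ?tm /= ?rt //.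
  by rewrite cats1 R.
have W3 : occurs s (wrap true true true false) = occurs s m.
  by rewrite /wrap /= cats1 -!rcons_cons B /= ?bl ?bt // L /= ?lt // T.
have [a1T|a1F] := boolP a1; last first.
  by rewrite -W0; apply/occurs_subseq/wrap_subseq; rewrite ?implybT ?(negPf a1F).
have [a2T|a2F] := boolP a2; last first.
  by rewrite -W1; apply/occurs_subseq/wrap_subseq; rewrite ?implybT ?(negPf a2F).
have [a3T|a3F] := boolP a3; last first.
  by rewrite -W2; apply/occurs_subseq/wrap_subseq; rewrite ?implybT ?(negPf a3F).
rewrite a1T a2T a3T /= in Ha *.
by rewrite -W3; apply/occurs_subseq/wrap_subseq; rewrite ?implybT ?(negPf Ha).
Qed.

Lemma subseq_consP (u v : seq nat) x : subseq u (x :: v) ->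
  subseq u v \/ exists2 u', u = x :: u' & subseq u' v.
Proof.
case: u => [|y u] /=; first by left; apply: sub0seq.
by case: eqP => [->|_] uv; [right; exists u | left].
Qed.

Lemma subseq_rconsP (u v : seq nat) x : subseq u (rcons v x) ->
  subseq u v \/ exists2 u', u = rcons u' x & subseq u' v.
Proof.
rewrite -subseq_rev rev_rcons => /subseq_consP[|[u' eq_u u'v]].
  by rewrite subseq_rev; left.
by right; exists (rev u'); rewrite -1?[u]revK ?eq_u ?rev_cons // -subseq_rev revK.
Qed.

Lemma occurs_full s : occurs s (wrap true true true true) ->
  (exists2 u, subseq u m & oiso s (l :: t :: u ++ [:: b; r])) \/
  occurs_triple s.
Proof.
case/occursP=> u + su; rewrite -[wrap _ _ _ _]/(l :: t :: m ++ [:: b; r]).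
have occ v : subseq u v -> occurs s v by move=> uv; apply/occursP; exists u.
case/subseq_consP=> [H|[u1 eq_u]].
  by right; apply/or4P/Or41/occ.
case/subseq_consP=> [H|[u2 eq_u1]].
  by right; apply/or4P/Or42/occ; rewrite eq_u /wrap /= eqxx.
rewrite -(cat1s b) catA !cats1.
case/subseq_rconsP=> [H|[u3 eq_u2]].
  by right; apply/or4P/Or44/occ; rewrite eq_u eq_u1 /wrap /= !eqxx -cats1 in H *.
case/subseq_rconsP=> [H|[u4 eq_u3 H]].
  right; apply/or4P/Or43/occ; rewrite eq_u eq_u1 eq_u2 /wrap /= !eqxx -!cats1.
  by rewrite cat_subseq.
by left; exists u4 => //; move: su; rewrite eq_u eq_u1 eq_u2 eq_u3 -!cats1 -catA.
Qed.

(** A single point occurs in all 16 wraps, and half of the signs are negative. *)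
Lemma altsum_seq1 s : size s = 1 -> 0 < size m ->
  altsum (fun w => Posz (occurs s w)) = 0%R.
Proof.
case: s => [|x []] // _ m_gt0.
have occ a1 a2 a3 a4 : occurs [:: x] (wrap a1 a2 a3 a4).
  by apply: occurs_seq1; rewrite !size_cat; lia.
by rewrite altsumE !occ.
Qed.

(** All terms other than that of the full wrap equal the term of [m], and their
signs add up to -1. *)
Lemma altsum_corner_free s : framed -> corner_free s ->
  altsum (fun w => Posz (occurs s w)) =
  (Posz (occurs s (wrap true true true true)) - Posz (occurs s m))%R.
Proof.
move=> Hframed s_cf.
rewrite altsumE; set full := occurs s (wrap true true true true).
rewrite !(occurs_corner_free Hframed s_cf) //; ring.
Qed.

(** A pattern of length at least 2 that begins with its minimum or ends with its
maximum neither begins with its maximum nor ends with its minimum, so one of the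
two cancellations applies to every pattern. *)
Lemma altsum_decomposable s : framed -> 0 < size s -> 0 < size m ->
  (occurs s (wrap true true true true) -> occurs_triple s) ->
  altsum (fun w => Posz (occurs s w)) = 0%R.
Proof.
move=> Hframed s_gt0 m_gt0 Hfull.
have [s_le1|s_gt1] := leqP (size s) 1.
  by apply: altsum_seq1 => //; apply/eqP; rewrite eqn_leq s_le1.
have ext2 d v : 1 < size v -> first_extreme d v -> ~~ first_extreme (~~ d) v.
  by case: v => [|x [|y v]] //= _ /andP[/below_asym xy _]; rewrite below_negb (negPf xy).
have extrev d v : 1 < size v -> first_extreme d v -> ~~ first_extreme d (rev v).
  case: v => [|x v] //= + xv; elim/last_ind: v xv => [|v y _] //.
  rewrite rev_cons rev_rcons all_rcons /= => /andP[/below_asym xy _] _.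
  by rewrite all_rcons (negPf xy).
have extrev' d v : 1 < size v -> first_extreme d (rev v) -> ~~ first_extreme d v.
  by move=> v_gt1 /extrev; rewrite size_rev revK; apply.
have [/orP[H|H]|] := boolP (first_extreme true s || first_extreme false (rev s)).
- by apply: altsum_cancel_sum => //; [apply: (ext2 true)|apply: extrev].
- by apply: altsum_cancel_sum => //; [apply: extrev'|apply: (ext2 false); rewrite ?size_rev].
- by rewrite negb_or => /andP[]; apply: altsum_cancel_skew.
Qed.

End Wrap.

Lemma rev_wrap l t m b r a1 a2 a3 a4 :
  rev (wrap l t m b r a1 a2 a3 a4) = wrap r b (rev m) t l a4 a3 a2 a1.
Proof. by rewrite /wrap !rev_cat -!catA; case: a1 a2 a3 a4 => [] [] [] []. Qed.

Lemma corner_free_wrap l t m b r :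
  framed l t m b r -> corner_free (wrap l t m b r true true true true).
Proof.
case/framedP=> /and5P[bl br bt lr /andP[lt rt]] _ _ _ _.
have le x y : x < y -> (y < x) = false by move=> /ltnW; rewrite ltnNge => ->.
rewrite /corner_free rev_wrap /wrap /= !all_cat /= (le b l) // (le l t) // (le b r) // (le r t) //.
by rewrite !(andbF, orbT).
Qed.

Lemma oiso_cons_map x u y v :
  [seq x < z | z <- u] = [seq y < z | z <- v] ->
  [seq z < x | z <- u] = [seq z < y | z <- v] ->
  oiso u v -> oiso (x :: u) (y :: v).
Proof.
move=> H1 H2 /oisoP[eq_sz H]; apply/oisoP; rewrite /= eq_sz; split=> // -[|i] [|j] /=;
  rewrite ?ltnn ?ltnS // => lti ltj.
- by have := congr1 (fun w => nth false w j) H1; rewrite !(nth_map 0) ?eq_sz.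
- by have := congr1 (fun w => nth false w i) H2; rewrite !(nth_map 0) ?eq_sz.
- by rewrite H ?eq_sz.
Qed.

Lemma map_all (T : Type) (p : T -> bool) c s : all (fun x => p x == c) s ->
  [seq p x | x <- s] = nseq (size s) c.
Proof. by elim: s => //= x s IH /andP[/eqP-> /IH->]. Qed.

(** With all four outer points present none of them is extreme and at an end, so the
first one has to be compared with every other entry; once it is removed, the
remaining ones can be stripped as extreme end points. *)
Lemma oiso_wrap l t m b r l' t' m' b' r' :
  framed l t m b r -> framed l' t' m' b' r' -> oiso m m' ->
  oiso (wrap l t m b r true true true true) (wrap l' t' m' b' r' true true true true).
Proof.
move=> C C' mm'; have eq_sz := oiso_size mm'.
have [/and5P[bl br bt lr /andP[lt rt]] lm bm rm tm] := framedP C.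
have [/and5P[bl' br' bt' lr' /andP[lt' rt']] lm' bm' rm' tm'] := framedP C'.
have le x y : x < y -> (y < x) = false by move=> /ltnW; rewrite ltnNge => ->.
have gtm x (v : seq nat) : all (below true x) v ->
    [seq x < z | z <- v] = nseq (size v) true /\ [seq z < x | z <- v] = nseq (size v) false.
  by move=> /allP xv; split; apply: map_all; apply/allP=> z /xv /= ltxz; rewrite ?ltxz // (le _ _ ltxz).
have [l1 l2] := gtm _ _ lm; have [l1' l2'] := gtm _ _ lm'.
have rc d x u y v : all (below d x) u -> all (below d y) v -> oiso u v ->
    oiso (rcons u x) (rcons v y).
  move=> xu yv uv; rewrite -[rcons u x]revK -[rcons v y]revK; apply: oiso_rev.
  by rewrite !rev_rcons; apply: (@oiso_cons d); rewrite ?all_rev //; apply: oiso_rev.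
rewrite /wrap /=; apply: oiso_cons_map.
- by rewrite /= !map_cat /= l1 l1' eq_sz lt lt' lr lr' (le _ _ bl) (le _ _ bl').
- by rewrite /= !map_cat /= l2 l2' eq_sz bl bl' (le _ _ lt) (le _ _ lt') (le _ _ lr) (le _ _ lr').
apply: (@oiso_cons false); rewrite ?all_cat ?tm ?tm' /= ?bt ?bt' ?rt ?rt' //.
rewrite -(cat1s b) -(cat1s b') !catA !cats1.
by apply: (rc false); rewrite ?all_rcons /= ?br ?br' //; apply: (rc true).
Qed.

Lemma oiso_wrap_inv l t m b r l' t' m' b' r' :
  oiso (wrap l t m b r true true true true) (wrap l' t' m' b' r' true true true true) ->
  oiso m m'.
Proof.
move=> /oiso_behead/oiso_behead/oiso_rev; rewrite !rev_cat /=.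
by move=> /oiso_behead/oiso_behead/oiso_rev; rewrite !revK.
Qed.

(** * Containment in a balloon *)

Lemma mem_olperm (p : olperm) x : x \in word p -> 0 < x <= size p.
Proof.
have /andP[_ Hp] := olpermP p.
by rewrite (perm_mem Hp) mem_iota add1n ltnS.
Qed.

Lemma uniq_olperm (p : olperm) : uniq p.
Proof. by have /andP[_ /perm_uniq ->] := olpermP p; apply: iota_uniq. Qed.

Lemma size_olperm_gt0 (p : olperm) : 0 < size p.
Proof. by have /andP[] := olpermP p. Qed.

Lemma oiso_olperm (s p : olperm) : oiso s p -> s = p.
Proof.
move=> sp; apply: contains_eq_size; last exact: oiso_size.
by rewrite -le_olpermE containsE; apply/occursP; exists p.
Qed.

Lemma p1_le (p : olperm) : (p1 <= p)%O.
Proof. by rewrite containsE occurs_seq1 ?size_olperm_gt0. Qed.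

Lemma size_p1 (p : olperm) : (size p == 1) = (p == p1).
Proof.
apply/eqP/eqP=> [sz|-> //]; apply/esym/contains_eq_size; last by rewrite sz.
by rewrite -le_olpermE p1_le.
Qed.

Lemma framed_subseq l t m b r u : subseq u m -> framed l t m b r -> framed l t u b r.
Proof.
move=> um /and4P[bl lr rt /allP H]; apply/and4P; split=> //.
by apply/allP=> x /(mem_subseq um)/H.
Qed.

Lemma occurs_addn k s p : occurs s [seq x + k | x <- p] = occurs s p.
Proof.
apply/occursP/occursP=> -[u].
  case/subseqP=> a sz_a ->; rewrite -map_mask => su.
  exists (mask a p); first exact: mask_subseq.
  by apply: oiso_trans su _; rewrite oiso_sym oiso_addn.
move=> up su; exists [seq x + k | x <- u]; first exact: map_subseq.
exact: oiso_trans su (oiso_addn _ _).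
Qed.

Definition balloon_wrap (p : olperm) : bool -> bool -> bool -> bool -> seq nat :=
  wrap 2 (size p + 4) [seq x + 2 | x <- p] 1 (size p + 3).

Lemma framed_balloon (p : olperm) : framed 2 (size p + 4) [seq x + 2 | x <- p] 1 (size p + 3).
Proof.
have p_gt0 := size_olperm_gt0 p.
apply/and4P; split; rewrite ?addnS ?ltnS ?addn0 //.
by apply/allP=> _ /mapP[x /mem_olperm xp ->]; lia.
Qed.

Lemma word_balloon (p : olperm) : word (balloon2413 p) = balloon_wrap p true true true true.
Proof. by []. Qed.

(** 2413 counts as the balloon of the empty word, which is not among the
permutations. *)
Definition is_balloon (p : olperm) : bool :=
  (p == p2413) || (p \in [seq balloon2413 q | q <- olperms_upto (size p)]).

Lemma is_balloonP p : reflect (p = p2413 \/ exists q, p = balloon2413 q) (is_balloon p).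
Proof.
apply: (iffP orP) => [[/eqP|/mapP[q _ ->]]|[->|[q ->]]]; rewrite ?eqxx; try by left.
  by right; exists q.
by right; apply: map_f; rewrite mem_olperms_upto size_balloon2413 leq_addr.
Qed.

Lemma corner_free_balloon p : is_balloon p -> corner_free p.
Proof.
case/is_balloonP=> [->//|[q ->]]; rewrite word_balloon.
exact/corner_free_wrap/framed_balloon.
Qed.

Lemma balloon_ge (p : olperm) : (p <= balloon2413 p)%O.
Proof.
rewrite containsE word_balloon.
apply: (@occurs_subseq _ (balloon_wrap p false false false false)); first exact: wrap_subseq.
by rewrite /balloon_wrap /wrap /= cats0 occurs_addn oiso_occurs ?oiso_refl.
Qed.

(** A pattern that uses all four outer points is the balloon of the pattern left
inside, which is empty for 2413. *)
Lemma oiso_full_balloon (s p : olperm) u :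
  subseq u [seq x + 2 | x <- p] ->
  oiso s (2 :: size p + 4 :: u ++ [:: 1; size p + 3]) ->
  s = p2413 \/ exists2 q, s = balloon2413 q & (q <= p)%O.
Proof.
move=> up; have C := framed_subseq up (framed_balloon p).
rewrite -[_ :: _]/(wrap 2 (size p + 4) u 1 (size p + 3) true true true true) => su.
have [u0|u_gt0] := posnP (size u).
  left; apply: oiso_olperm; apply: oiso_trans su _.
  rewrite (size0nil u0) in C *; exact: (@oiso_wrap _ _ _ _ _ 2 4 [::] 1 3 C isT (oiso_refl _)).
have uu : uniq u.
  apply: subseq_uniq up _; rewrite map_inj_uniq ?uniq_olperm //.
  by move=> x y /addIn.
pose q := OLPerm (std_olperm uu u_gt0).
have uq : oiso u q by apply: oiso_std.
right; exists q.
  apply: oiso_olperm; apply: oiso_trans su _; rewrite word_balloon.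
  apply: oiso_wrap (framed_balloon q) _ => //.
  exact: oiso_trans uq (oiso_addn _ _).
rewrite containsE -(occurs_addn 2); apply/occursP; exists u => //.
by rewrite oiso_sym.
Qed.

Lemma le_balloon_cases (s p : olperm) : (s <= balloon2413 p)%O ->
  (s = p2413 \/ exists2 q, s = balloon2413 q & (q <= p)%O) \/
  occurs_triple 2 (size p + 4) [seq x + 2 | x <- p] 1 (size p + 3) s.
Proof.
rewrite containsE word_balloon => /occurs_full[[u up su]|H]; last by right.
by left; apply: oiso_full_balloon su.
Qed.

Lemma le_balloon_corner_free (s p : olperm) : corner_free s -> (s <= balloon2413 p)%O ->
  (s = p2413 \/ exists2 q, s = balloon2413 q & (q <= p)%O) \/ (s <= p)%O.
Proof.
move=> s_cf /le_balloon_cases[|H]; [by left|right].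
move: H; rewrite /occurs_triple !(occurs_corner_free (framed_balloon p) s_cf) // !orbb.
by rewrite occurs_addn -containsE.
Qed.

Lemma balloon_inj : injective balloon2413.
Proof.
move=> p q eq_pq; apply: oiso_olperm; rewrite oiso_sym.
have eq_sz : size p = size q.
  by apply/(@addIn 4); rewrite -!size_balloon2413 eq_pq.
have : oiso (balloon_wrap p true true true true) (balloon_wrap q true true true true).
  by rewrite -!word_balloon eq_pq oiso_refl.
move/oiso_wrap_inv => H; rewrite oiso_sym; apply: oiso_trans (oiso_addn 2 _) _.
by apply: oiso_trans H _; rewrite oiso_sym oiso_addn.
Qed.

(** The balloon of [p] is corner-free. If it does not use all outer points of the
balloon of [q], then it is therefore contained in [q], and so is [p]. *)
Lemma le_balloon (p q : olperm) : (balloon2413 p <= balloon2413 q)%O = (p <= q)%O.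
Proof.
apply/idP/idP=> [H|].
  have cf : corner_free (balloon2413 p).
    by apply/corner_free_balloon/is_balloonP; right; exists p.
  case: (le_balloon_corner_free cf H) => [[/(congr1 (fun w : olperm => size w))|[q' /balloon_inj->//]]|].
    by rewrite size_balloon2413 /=; have := size_olperm_gt0 p; lia.
  exact: le_trans (balloon_ge p).
rewrite !containsE => /occursP[u uq pu]; apply/occursP.
pose u2 := [seq x + 2 | x <- u].
have u2q : subseq u2 [seq x + 2 | x <- q] by apply: map_subseq.
exists (wrap 2 (size q + 4) u2 1 (size q + 3) true true true true).
  by rewrite word_balloon /balloon_wrap /wrap /= !eqxx cat_subseq.
rewrite word_balloon; apply: oiso_wrap (framed_balloon p) _ _.
  exact: framed_subseq u2q (framed_balloon q).
by apply: oiso_trans (oiso_trans pu (oiso_addn 2 _)); rewrite oiso_sym oiso_addn.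
Qed.

Lemma le_2413_balloon (p : olperm) : (p2413 <= balloon2413 p)%O.
Proof.
rewrite containsE; apply/occursP.
exists (wrap 2 (size p + 4) [::] 1 (size p + 3) true true true true).
  by rewrite word_balloon /balloon_wrap /wrap /= !eqxx suffix_subseq.
apply: (@oiso_wrap 2 4 [::] 1 3 _ _ _ _ _ isT _ (oiso_refl _)).
exact: framed_subseq (sub0seq _) (framed_balloon p).
Qed.

Local Open Scope ring_scope.

Lemma altsum_balloon (p s : olperm) :
  altsum 2 (size p + 4) [seq (x + 2)%N | x <- p] 1 (size p + 3)
    (fun w => Posz (occurs s w)) =
  if is_balloon s then Posz (s <= balloon2413 p)%O - Posz (s <= p)%O else 0.
Proof.
case: (boolP (is_balloon s)) => [s_b|s_nb].
  rewrite altsum_corner_free ?framed_balloon ?corner_free_balloon //.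
  by rewrite occurs_addn -[wrap _ _ _ _ _ _ _ _ _]word_balloon -!containsE.
apply: altsum_decomposable; rewrite ?framed_balloon ?size_map ?size_olperm_gt0 //.
rewrite -[wrap _ _ _ _ _ true true true true]word_balloon -containsE.
case/le_balloon_cases=> // H; case/is_balloonP: s_nb.
by case: H => [|[q ? _]]; [left|right; exists q].
Qed.

(** * The Moebius function of a balloon *)

Lemma sum_le_olperm (F : olperm -> int) (p : olperm) N : (size p <= N)%N ->
  \sum_(s <- olperms_upto N | (s <= p)%O) F s =
  F p + \sum_(s <- olperms_upto (size p) | (s < p)%O) F s.
Proof.
move=> le_pN.
transitivity (\sum_(s <- p :: [seq s <- olperms_upto (size p) | (s < p)%O]) F s).
  rewrite -big_filter; apply: perm_big; apply: uniq_perm.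
  - by rewrite filter_uniq ?uniq_olperms_upto.
  - by rewrite /= mem_filter ltxx filter_uniq ?uniq_olperms_upto.
  move=> s; rewrite inE !mem_filter !mem_olperms_upto le_eqVlt.
  case: eqVneq => [->//|_ /=].
  by case: (boolP (s < p)%O) => //= /lt_olperm_size/ltnW sp; rewrite sp (leq_trans sp).
by rewrite big_cons big_filter.
Qed.

Lemma moebius_sum (p : olperm) N : (size p <= N)%N ->
  \sum_(s <- olperms_upto N | (s <= p)%O) moebius p1 s = Posz (p == p1).
Proof.
move=> le_pN; rewrite sum_le_olperm //.
have [->|np1] := eqVneq p p1.
  rewrite moebius_refl big1 ?addr0 // => s sp1.
  by have := le_lt_trans (p1_le s) sp1; rewrite ltxx.
rewrite moebius_rec; last by rewrite lt_neqAle eq_sym np1 p1_le.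
by apply/eqP; rewrite addrC subr_eq0; apply/eqP; apply: eq_bigl => s; rewrite p1_le.
Qed.

(** The vanishing of the Moebius sums over principal ideals, for words with distinct
entries, so that it applies to all 16 wraps at once. *)
Lemma moebius_word_sum (w : seq nat) N : uniq w -> (0 < size w <= N)%N ->
  \sum_(s <- olperms_upto N) moebius p1 s * Posz (occurs s w) = Posz (size w == 1)%N.
Proof.
move=> uw /andP[w_gt0 le_wN]; pose p := OLPerm (std_olperm uw w_gt0).
have sz_p : size p = size w by rewrite size_map.
rewrite -sz_p size_p1 -(@moebius_sum p N) ?sz_p // [RHS]big_mkcond /=.
apply: eq_bigr => s _; rewrite containsE.
have wp : oiso w p by apply: oiso_std.
have -> : occurs s p = occurs s w.
  apply/idP/idP=> /occurs_trans; apply; apply: oiso_occurs => //.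
  by rewrite oiso_sym.
by case: ifP; rewrite ?mulr1 ?mulr0.
Qed.

(** Only the wrap without outer points can have length 1. *)
Lemma altsum_moebius l t m b r N : uniq (wrap l t m b r true true true true) ->
  (0 < size m)%N -> (size m + 4 <= N)%N ->
  \sum_(s <- olperms_upto N)
    moebius p1 s * altsum l t m b r (fun w => Posz (occurs s w)) = Posz (size m == 1)%N.
Proof.
move=> uw m_gt0 le_mN.
have E a1 a2 a3 a4 :
    \sum_(s <- olperms_upto N) moebius p1 s * Posz (occurs s (wrap l t m b r a1 a2 a3 a4)) =
    Posz (~~ [|| a1, a2, a3 | a4] && (size m == 1))%N.
  have sz : size (wrap l t m b r a1 a2 a3 a4) = (a1 + a2 + size m + a3 + a4)%N.
    by rewrite /wrap !size_cat !size_nseq; lia.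
  rewrite moebius_word_sum.
  - by rewrite sz; congr (Posz (nat_of_bool _)); case: a1 a2 a3 a4 {sz} => [] [] [] [] /=; lia.
  - apply: subseq_uniq (wrap_subseq _ _ _ _ _ _ _ _ _) uw; exact: implybT.
  - by rewrite sz; case: a1 a2 a3 a4 {sz} => [] [] [] []; lia.
under eq_bigr => s _ do rewrite altsumE !(mulrDr, mulrN).
rewrite !(big_split, sumrN) /= !E /= !(subr0, addr0) //.
Qed.

(** The two computations of the alternating sums, pattern by pattern and wrap by
wrap, compared. *)
Lemma balloon_sum (p : olperm) :
  moebius p1 p2413 + \sum_(q <- olperms_upto (size p) | (q <= p)%O) moebius p1 (balloon2413 q)
  - \sum_(q <- olperms_upto (size p) | (q <= p)%O) (is_balloon q)%:R * moebius p1 q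
  = Posz (p == p1).
Proof.
have <- : \sum_(s <- olperms_upto (size p + 4)) moebius p1 s *
    (if is_balloon s then Posz (s <= balloon2413 p)%O - Posz (s <= p)%O else 0) = Posz (p == p1).
  have := @altsum_moebius 2 (size p + 4) [seq (x + 2)%N | x <- p] 1 (size p + 3) (size p + 4).
  rewrite size_map size_p1 => <- //; last exact: size_olperm_gt0.
    by apply: eq_bigr => s _; rewrite altsum_balloon.
  exact: (uniq_olperm (balloon2413 p)).
rewrite [RHS](eq_bigr (fun s => (if is_balloon s && (s <= balloon2413 p)%O then moebius p1 s else 0) -
                    (if (s <= p)%O then (is_balloon s)%:R * moebius p1 s else 0))); last first.
  by move=> s _; case: is_balloon; case: (s <= p)%O; case: (s <= balloon2413 p)%O => /=; ring.
rewrite [RHS]sumrB -!big_mkcond /=; congr (_ - _).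
  transitivity (\sum_(s <- p2413 :: [seq balloon2413 q | q <- olperms_upto (size p) & (q <= p)%O])
      moebius p1 s); first by rewrite big_cons big_map big_filter.
  rewrite -[RHS]big_filter; apply: perm_big; apply: uniq_perm.
  - rewrite /= map_inj_uniq ?filter_uniq ?uniq_olperms_upto ?andbT //; last exact: balloon_inj.
    apply/mapP=> -[q _ /(congr1 (fun w : olperm => size w))].
    by rewrite size_balloon2413 /=; have := size_olperm_gt0 q; lia.
  - by rewrite filter_uniq ?uniq_olperms_upto.
  move=> s; rewrite inE !mem_filter mem_olperms_upto; apply/orP/andP.
    case=> [/eqP->|/mapP[q]].
      rewrite le_2413_balloon andbT; split; last by have := size_olperm_gt0 p; rewrite /=; lia.
      by apply/is_balloonP; left.
    rewrite mem_filter => /andP[qp _ ->]; rewrite le_balloon qp andbT; split.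
      by apply/is_balloonP; right; exists q.
    by rewrite size_balloon2413 leq_add2r contains_size.
  case=> /andP[/is_balloonP[->|[q ->]]]; first by rewrite eqxx; left.
  rewrite le_balloon => qp _; right; apply: map_f.
  by rewrite mem_filter qp mem_olperms_upto contains_size.
rewrite -big_filter -[RHS]big_filter; apply: perm_big.
apply: uniq_perm; rewrite ?filter_uniq ?uniq_olperms_upto // => s.
rewrite !mem_filter !mem_olperms_upto.
by case: (boolP (s <= p)%O) => //= /contains_size sp; rewrite sp (leq_trans sp) // leq_addr.
Qed.

(** By [balloon_sum] and [moebius_sum], the difference of the two sides sums to zero
over every principal ideal. Such a function is zero, by induction on the length. *)
Lemma moebius_balloon (p : olperm) :
  moebius p1 (balloon2413 p) =
  (1 + (is_balloon p)%:R) * moebius p1 p - moebius p1 p2413 * (p == p1)%:R.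
Proof.
pose G (q : olperm) : int := moebius p1 (balloon2413 q) -
  ((1 + (is_balloon q)%:R) * moebius p1 q - moebius p1 p2413 * (q == p1)%:R).
(* The constant [moebius p1 p2413] of [balloon_sum] comes from the term of [G]
   concentrated at 1, which lies in every principal ideal. *)
have sumG (q : olperm) : \sum_(s <- olperms_upto (size q) | (s <= q)%O) G s = 0.
  have S1 := moebius_sum (leqnn (size q)); have S2 := balloon_sum q.
  have S3 : \sum_(s <- olperms_upto (size q) | (s <= q)%O) ((s == p1)%:R : int) = 1.
    rewrite big_mkcond (bigD1_seq p1) ?mem_olperms_upto ?uniq_olperms_upto ?size_olperm_gt0 //=.
    by rewrite p1_le ?eqxx big1 ?addr0 // => s /negPf ->; rewrite if_same.
  rewrite /G; under eq_bigr => s _ do rewrite mulrDl mul1r.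
  rewrite !sumrB big_split /= -mulr_sumr S3 S1.
  move: S2; set A := bigop _ _ _; set B := bigop _ _ _; set c := moebius _ _.
  by rewrite -/B => <-; ring.
suff: forall n (q : olperm), (size q <= n)%N -> G q = 0.
  by move/(_ _ p (leqnn _))/eqP; rewrite subr_eq0 => /eqP.
elim=> [|n IH] q le_q; first by have := size_olperm_gt0 q; rewrite ltnNge le_q.
have := sumG q; rewrite sum_le_olperm // big1 ?addr0 // => s /lt_olperm_size sq.
by apply: IH; rewrite -ltnS (leq_trans sq).
Qed.

Lemma moebius_p12 : moebius p1 p12 = -1.
Proof.
have := moebius_sum (leqnn (size p12)); rewrite sum_le_olperm //.
rewrite (eq_bigl (fun s => (s <= p1)%O)) => [|s].
  by rewrite moebius_sum // eqxx => /eqP; rewrite addr_eq0 => /eqP.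
apply/idP/idP=> [/lt_olperm_size sz|/le_lt_trans]; last by apply; rewrite lt_neqAle p1_le.
  suff /eqP-> : s == p1 by [].
  by rewrite -size_p1; have := size_olperm_gt0 s; move: sz => /=; lia.
Qed.

(** The iteration starts at 12, the first balloon step keeps the value -1 because 12
is not a balloon, and every later one doubles it. *)
Lemma moebius_iter_balloon k : moebius p1 (iter k.+1 balloon2413 p12) = - 2 ^+ k.
Proof.
elim: k => [|k IH].
  rewrite /= moebius_balloon moebius_p12.
  have -> : is_balloon p12 = false by apply/negP=> /corner_free_balloon.
  by rewrite -size_p1 /= expr0; ring.
rewrite iterS moebius_balloon IH.
have -> : is_balloon (iter k.+1 balloon2413 p12).
  by apply/is_balloonP; right; exists (iter k balloon2413 p12).
have -> : (iter k.+1 balloon2413 p12 == p1) = false.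
  by rewrite -size_p1 iterS size_balloon2413 addn4.
by rewrite exprS mulr0n mulr0 subr0 mulr1n mulrN.
Qed.

Local Close Scope ring_scope.

Lemma pi_iter k : pi_ (4 * k + 2) = iter k balloon2413 p12.
Proof.
elim: k => // k IH; rewrite pi_rec; last by lia.
by rewrite iterS -IH; congr (balloon2413 (pi_ _)); lia.
Qed.

Lemma unbounded_pi_class : unbounded_on (moebius p1) pi_class.
Proof.
move=> M; exists (pi_ (4 * (absz M).+1 + 2)); split.
  by exists (4 * (absz M).+1 + 2); rewrite lexx; split=> //; lia.
rewrite pi_iter moebius_iter_balloon normrN normrX ger0_norm //.
apply: (@le_lt_trans _ _ (Posz (absz M))); first by rewrite abszE ler_norm.
by rewrite -[Posz (absz M)]natz -natrX ltr_nat ltn_expl.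
Qed.

Lemma hereditary_pi_class : hereditary_class pi_class.
Proof. by move=> s p sp [n [n_gt0 pn]]; exists n; split=> //; apply: le_trans pn. Qed.

(** * Simple permutations *)

(** A factor whose values are consecutive is an interval. *)
Lemma simple_factor (p : olperm) s1 v s2 a :
  word p = s1 ++ v ++ s2 -> 0 < size v -> perm_eq v (iota a (size v)) ->
  simple_olperm p -> size v = 1 \/ size v = size p.
Proof.
move=> eq_p v_gt0 Hv /(_ (size s1) (size s1 + (size v).-1)) [|H|H].
- split; first by rewrite eq_p !size_cat; lia.
  exists a, (a + (size v).-1) => x.
  have -> : (a <= x <= a + (size v).-1) = (x \in v).
    by rewrite (perm_mem Hv) mem_iota; lia.
  split=> [[k [Hk <-]]|/(nthP 0)[i lti <-]].
    have [lek ltk] : size s1 <= k /\ k - size s1 < size v by lia.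
    by rewrite eq_p nth_cat ltnNge lek /= nth_cat ltk mem_nth.
  exists (size s1 + i); split; first by rewrite leq_addr leq_add2l -ltnS prednK.
  by rewrite eq_p nth_cat ltnNge leq_addr /= addKn nth_cat lti.
- by left; lia.
- by right; lia.
Qed.

(** Removing the least or the greatest value leaves consecutive values. *)
Lemma perm_behead_iota d x v :
  perm_eq (x :: v) (iota 1 (size v).+1) -> first_extreme d (x :: v) ->
  exists a, perm_eq v (iota a (size v)).
Proof.
move=> Hp /= /allP xv; have Hm := perm_mem Hp.
have x_iota : x \in iota 1 (size v).+1 by rewrite -Hm mem_head.
have memv y : y \in iota 1 (size v).+1 -> y = x \/ y \in v.
  by rewrite -Hm inE => /orP[/eqP|]; [left|right].
move: x_iota; rewrite mem_iota add1n ltnS => /andP[x_gt0 x_le].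
case: d xv => /= xv.
  have x1 : x = 1 by case: (memv 1); rewrite ?mem_head // => /xv; lia.
  by exists 2; rewrite -(perm_cons 1) -{1}x1.
have xn : x = (size v).+1.
  by case: (memv (size v).+1); rewrite ?mem_iota ?add1n ?ltnS ?leqnn // => /xv; lia.
exists 1; rewrite -(perm_cons x) (perm_trans Hp) //.
by rewrite -[(size v).+1]addn1 iotaD add1n -xn perm_catC.
Qed.

Lemma simple_corner_free (p : olperm) :
  simple_olperm p -> 2 < size p -> corner_free p.
Proof.
move=> p_s p_gt2; have /andP[_ Hp] := olpermP p.
have F d : ~~ first_extreme d p.
  apply/negP; case eq_p: (word p) p_gt2 Hp => [|x v] //= v_gt1 Hp /(perm_behead_iota Hp)[a Ha].
  have := @simple_factor p [:: x] v [::] a.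
  by rewrite cats0 eq_p => /(_ erefl _ Ha p_s) /=; lia.
have L d : ~~ first_extreme d (rev p).
  apply/negP; rewrite -size_rev -(perm_rev p) in p_gt2 Hp.
  case eq_p: (rev p) p_gt2 Hp => [|x v] //= v_gt1 Hp /(perm_behead_iota Hp)[a Ha].
  have := @simple_factor p [::] (rev v) [:: x] a.
  rewrite -[word p]revK eq_p rev_cons -cats1 size_rev perm_rev => /(_ erefl _ Ha p_s).
  by rewrite size_cat size_rev /=; lia.
by rewrite /corner_free !F !L.
Qed.

Lemma small_olperm (p : olperm) : size p <= 2 -> p \in [:: p1; p12; p21].
Proof.
move=> le_p2; have /andP[p_gt0 Hp] := olpermP p.
rewrite !inE -!(inj_eq val_inj) /=.
move: p_gt0 Hp; case: (word p) le_p2 => [|x [|y []]] //= _ _.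
  by move/perm_mem/(_ x); rewrite !inE eqxx => /esym/eqP->.
rewrite -mem_permutations; have -> : permutations (iota 1 2) = [:: [:: 1; 2]; [:: 2; 1]] by [].
by rewrite !inE => /orP[]/eqP->.
Qed.

(** By induction along the sequence, a corner-free permutation of the class is 2413
or a balloon; the permutations of length at most 2 are listed, and a simple
balloon has only one point inside. *)
Lemma simple_pi_class (p : olperm) :
  pi_class p -> simple_olperm p -> p \in [:: p1; p12; p21; p2413; p25314].
Proof.
case=> n [n_gt0 pn] p_s.
have [/small_olperm|p_gt2] := leqP (size p) 2.
  by rewrite !inE => /or3P[] ->; rewrite ?orbT.
have p_cf := simple_corner_free p_s p_gt2.
suff [->|[q eq_p]] : p = p2413 \/ exists q, p = balloon2413 q.
- by rewrite !inE eqxx !orbT.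
- have q1 : size q = 1.
    have := @simple_factor p [:: 2; size q + 4] [seq x + 2 | x <- q] [:: 1; size q + 3] 3.
    rewrite size_map eq_p size_balloon2413 => /(_ erefl (size_olperm_gt0 q)) H.
    have [|||] // := H _ _; last by lia.
      have /andP[_ Hq] := olpermP q.
      rewrite (iotaDl 2 1) (eq_map (g := addn 2)) ?perm_map // => x.
      by rewrite addnC.
    by rewrite -eq_p.
  move/eqP: q1; rewrite size_p1 => /eqP eq_q.
  have -> : p = p25314 by rewrite eq_p eq_q; apply/val_inj.
  by rewrite !inE eqxx !orbT.
elim/ltn_ind: n n_gt0 pn => n IH n_gt0 pn.
have [n_gt4|n_le4] := ltnP 4 n.
  rewrite pi_rec // in pn; case: (le_balloon_corner_free p_cf pn) => [[|[q]]|].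
  - by left.
  - by right; exists q.
  - by apply: IH; lia.
have := contains_size pn; case: n n_gt0 n_le4 pn {IH} => [|[|[|[|[|n]]]]] //= _ _ pn sz.
- by move: p_gt2; rewrite ltnNge (leq_trans sz).
- by move: p_gt2; rewrite ltnNge sz.
- have eq_p : p = p132 by apply: contains_eq_size; rewrite // /=; lia.
  by rewrite eq_p in p_cf.
left; move: pn; rewrite containsE -[word p2413]/(wrap 2 4 [::] 1 3 true true true true).
case/occurs_full=> [[u]|]; first by rewrite subseq0 => /eqP-> /(@oiso_olperm p p2413).
have C : framed 2 4 [::] 1 3 by [].
rewrite /occurs_triple !(occurs_corner_free C p_cf) // !orbb => /occursP[u].
rewrite subseq0 => /eqP -> /oiso_size sz0; by rewrite sz0 in p_gt2.
Qed.

Theorem mainTheorem4 :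
  (forall p : olperm,
     pi_class p -> simple_olperm p ->
     p \in [:: p1; p12; p21; p2413; p25314]) /\
  (hereditary_class pi_class /\ unbounded_on (moebius p1) pi_class) /\
  (exists C : olperm -> Prop,
     [/\ hereditary_class C,
         exists l : seq olperm, forall p : olperm,
           C p -> simple_olperm p -> p \in l &
         unbounded_on (moebius p1) C]).
Proof.
split; first exact: simple_pi_class.
split; first by split; [exact: hereditary_pi_class | exact: unbounded_pi_class].
exists pi_class; split; [exact: hereditary_pi_class | | exact: unbounded_pi_class].
exists [:: p1; p12; p21; p2413; p25314]; exact: simple_pi_class.
Qed.
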